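(* Let $\Phi$ be the map defined in the context below. Then $\Phi$ is a bijection from the set of triangulations of the strip to the set of $\mathrm{SL}_2$-tilings with enough ones.
   Context: Vertices of the strip: two disjoint copies of $\mathbb{Z}$, written $\mathbb{Z}^\circ=\{p^\circ: p\in\mathbb{Z}\}$ (upper edge) and $\mathbb{Z}_\circ=\{q_\circ : q\in\mathbb{Z}\}$ (lower edge). Geometrically, $p^\circ$ is the point $(-p,1)$ and $q_\circ$ is the point $(q,-1)$ of the strip $\mathbb{R}\times[-1,1]$ (so the two edges are numbered in opposite directions). A connecting arc is a pair $(p^\circ,q_\circ)$ with $p,q\in\mathbb{Z}$; an internal arc is a pair $(p^\circ,q^\circ)$ or $(p_\circ,q_\circ)$ with $p\le q-2$. Arcs are drawn as curves inside the strip joining their endpoints. Two distinct arcs cross exactly in the following cases: connecting arcs $(p^\circ,q_\circ),(p'^\circ,q'_\circ)$ cross iff $(p-p')(q-q')>0$; internal arcs $(a^\circ,b^\circ),(c^\circ,d^\circ)$ cross iff $a<c<b<d$ or $c<a<d<b$ (same for lower internal arcs $(a_\circ,b_\circ),(c_\circ,d_\circ)$); an internal arc $(a^\circ,b^\circ)$ crosses a connecting arc $(p^\circ,q_\circ)$ iff $a<p<b$, and $(a_\circ,b_\circ)$ crosses $(p^\circ,q_\circ)$ iff $a<q<b$; an upper internal arc never crosses a lower internal arc. (Arcs sharing only endpoints do not cross.) A triangulation of the strip is a maximal set $\mathfrak{T}$ of pairwise non-crossing arcs such that for every $(i,j)\in\mathbb{Z}^2$ there is $(p^\circ,q_\circ)\in\mathfrak{T}$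 with $p<i,\ q>j$, and there is $(p^\circ,q_\circ)\in\mathfrak{T}$ with $p>i,\ q<j$. An $\mathrm{SL}_2$-tiling is a map $t:\mathbb{Z}\times\mathbb{Z}\to\{1,2,3,\dots\}$, $(i,j)\mapsto t_{ij}$, with $t_{ij}t_{i+1,j+1}-t_{i,j+1}t_{i+1,j}=1$ for all $i,j$. It has enough ones if for every $(i,j)$ there is $(p,q)$ with $p<i,\ q>j$ and $t_{pq}=1$, and there is $(p,q)$ with $p>i,\ q<j$ and $t_{pq}=1$. Friese numbers of a triangulated polygon: let $P$ be a convex polygon with vertices $v_0,\dots,v_n$ in cyclic order ($n\ge 2$), with a triangulation $\mathcal{X}$; let $a_l$ be the number of triangles of $\mathcal{X}$ incident with $v_l$. For fixed $k$ define $m_k(l)$ for $l=k,k+1,\dots,k+n$ (indices mod $n+1$) by $m_k(k)=0$, $m_k(k+1)=1$, $m_k(l+1)=a_l m_k(l)-m_k(l-1)$, and put $\mathcal{X}(v_k,v_l)=m_k(l)$ (this is the Conway–Coxeter friese value; it is symmetric and a positive integer for $k\ne l$). The map $\Phi$: given a triangulation $\mathfrak{T}$ of the strip and $(i,j)\in\mathbb{Z}^2$, choose $(p^\circ,q_\circ),(r^\circ,s_\circ)\in\mathfrak{T}$ with $p<i<r$ and $s<j<q$. Let $P$ be the polygon with vertices, in cyclic order, $p^\circ,(p+1)^\circ,\dots,r^\circ,s_\circ,(s+1)_\circ,\dots,q_\circ$; the arcs of $\mathfrak{T}$ joining two vertices of $P$ other than the sides of $P$ form a triangulation $\mathfrak{T}_P$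 of $P$. Set $\Phi(\mathfrak{T})_{ij}=\mathfrak{T}_P(i^\circ,j_\circ)$. *)

(* Defs.v *)
From HB Require Import structures.
From mathcomp Require Import all_boot all_order all_algebra.
From Stdlib Require Import ClassicalEpsilon.
Set Implicit Arguments. Unset Strict Implicit. Unset Printing Implicit Defensive.
Import Order.TTheory GRing.Theory Num.Theory.
Local Open Scope ring_scope.

(* Vertices of the strip: [Up p] is p^o (upper edge), [Dn q] is q_o (lower edge). *)
Inductive vert := Up of int | Dn of int.

(* Arcs: [Conn p q] = (p^o, q_o); [UpA a b] = (a^o, b^o); [DnA a b] = (a_o, b_o). *)
Inductive arc := Conn of int & int | UpA of int & int | DnA of int & int.

Definition valid_arc (x : arc) : bool :=
  match x with
  | Conn _ _ => true
  | UpA a b => a <= b - 2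
  | DnA a b => a <= b - 2
  end.

Definition crosses (x y : arc) : bool :=
  match x, y with
  | Conn p q, Conn p' q' => 0 < (p - p') * (q - q')
  | UpA a b, UpA c d => [&& a < c, c < b & b < d] || [&& c < a, a < d & d < b]
  | DnA a b, DnA c d => [&& a < c, c < b & b < d] || [&& c < a, a < d & d < b]
  | UpA a b, Conn p q => (a < p) && (p < b)
  | Conn p q, UpA a b => (a < p) && (p < b)
  | DnA a b, Conn p q => (a < q) && (q < b)
  | Conn p q, DnA a b => (a < q) && (q < b)
  | UpA _ _, DnA _ _ => false
  | DnA _ _, UpA _ _ => false
  end.

Definition is_triangulation (T : arc -> bool) : Prop :=
  (forall x, T x -> valid_arc x) /\
  (forall x y, T x -> T y -> x <> y -> ~~ crosses x y) /\
  (forall x, valid_arc x -> (forall y, T y -> x <> y -> ~~ crosses x y) -> T x) /\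
  (forall i j : int, exists p q : int, T (Conn p q) /\ p < i /\ j < q) /\
  (forall i j : int, exists p q : int, T (Conn p q) /\ i < p /\ q < j).

Definition is_SL2_tiling (t : int -> int -> int) : Prop :=
  (forall i j, 0 < t i j) /\
  (forall i j, t i j * t (i + 1) (j + 1) - t i (j + 1) * t (i + 1) j = 1).

Definition enough_ones (t : int -> int -> int) : Prop :=
  forall i j : int,
    (exists p q : int, p < i /\ j < q /\ t p q = 1) /\
    (exists p q : int, i < p /\ q < j /\ t p q = 1).

(* Vertices in cyclic order v_0 = p^o, ..., v_(r-p) = r^o, v_(r-p+1) = s_o, ...,
   v_(N-1) = q_o, with N = (r-p+1) + (q-s+1). *)
Definition nup (p r : int) : nat := absz (r - p + 1).
Definition pN (p q r s : int) : nat := addn (absz (r - p + 1)) (absz (q - s + 1)).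

Definition pvert (p r s : int) (k : nat) : vert :=
  if (k < nup p r)%N then Up (p + k%:Z) else Dn (s + (k - nup p r)%N%:Z).

Definition joined (T : arc -> bool) (u v : vert) : bool :=
  match u, v with
  | Up a, Up b => T (UpA a b) || T (UpA b a)
  | Dn a, Dn b => T (DnA a b) || T (DnA b a)
  | Up a, Dn b => T (Conn a b)
  | Dn b, Up a => T (Conn a b)
  end.

Definition pside (N k l : nat) : bool :=
  (k.+1 == l) || (l.+1 == k) || ((k == 0%N) && (l == N.-1)) || ((l == 0%N) && (k == N.-1)).

Definition padj (T : arc -> bool) (p q r s : int) (k l : nat) : bool :=
  [&& (k < pN p q r s)%N, (l < pN p q r s)%N, k != l &
      pside (pN p q r s) k l || joined T (pvert p r s k) (pvert p r s l)].

(* a_l : number of triangles of T_P incident with v_l (a triangle being a triple of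
   pairwise joined vertices). *)
Definition ntri (T : arc -> bool) (p q r s : int) (l : nat) : int :=
  (\sum_(j < pN p q r s) \sum_(k < pN p q r s)
     [&& (j < k)%N, padj T p q r s l j, padj T p q r s l k & padj T p q r s j k] : nat)%:Z.

(* (m_k(k+t), m_k(k+t+1)) *)
Fixpoint mpair (a : nat -> int) (N k t : nat) : int * int :=
  match t with
  | 0 => (0, 1)
  | t'.+1 => let '(x, y) := mpair a N k t' in (y, a ((k + t').+1 %% N)%N * y - x)
  end.

(* Conway--Coxeter friese value X(v_k, v_l) = m_k(l) *)
Definition friese (a : nat -> int) (N k l : nat) : int :=
  (mpair a N k ((l + N - k) %% N)%N).1.

(* T_P(i^o, j_o) for the polygon determined by (p^o,q_o),(r^o,s_o) *)
Definition Phi_val (T : arc -> bool) (p q r s i j : int) : int :=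
  friese (ntri T p q r s) (pN p q r s) (absz (i - p)) (nup p r + absz (j - s))%N.

Definition Phi_choice_ok (T : arc -> bool) (i j : int) (c : int * int * int * int) : Prop :=
  let '(p, q, r, s) := c in
  T (Conn p q) /\ T (Conn r s) /\ p < i < r /\ s < j < q.

Definition Phi (T : arc -> bool) (i j : int) : int :=
  let '(p, q, r, s) := epsilon (inhabits (0, 0, 0, 0)) (Phi_choice_ok T i j) in
  Phi_val T p q r s i j.

(* Main.v *)
(** Represent the vertices of the strip by vectors of Z^2, and let det be the determinant.  On a
    triangulated polygon there are vectors V with [det (V x) (V y) = 1] for each side or arc
    xy (x before y): the apex of the triangle on the edge ab gets [V a + V b].  Counting triangles gives
    [V (l - 1) + V (l + 1) = n_l V l], so det(V k, V l) is the friese number of (k, l), whatever V is;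
    comparing with a larger polygon, this makes Phi well defined.  The Pluecker relation then gives the SL2
    condition, and shows that two crossing arcs cannot both have determinant 1; hence an arc belongs
    to T iff its determinant is 1, and all determinants are expressed through Phi T: this is injectivity.
    Conversely, an SL2-tiling has rank 2, so it is a table of determinants of vectors, positive along the
    strip.  The arcs of determinant 1 do not cross; in a polygon cut off by two ones of the tiling, every
    edge of determinant 1 carries a triangle, so they form a maximal set. *)

Require Import Defs.
From HB Require Import structures.
From mathcomp Require Import all_boot all_order all_algebra.
From mathcomp Require Import zify ring lra.
From Stdlib Require Import Classical ClassicalEpsilon.
Set Implicit Arguments. Unset Strict Implicit. Unset Printing Implicit Defensive.
Import Order.TTheory GRing.Theory Num.Theory.
Local Open Scope ring_scope.

(** * Determinants of pairs of integers *)

Definition det (u v : int * int) : int := u.1 * v.2 - u.2 * v.1.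

Lemma detxx u : det u u = 0.
Proof. by rewrite /det; ring. Qed.

Lemma det_plucker a b c d :
  det a c * det b d = det a b * det c d + det a d * det b c.
Proof. by rewrite /det; ring. Qed.

Lemma detDl u v w : det (u + v) w = det u w + det v w.
Proof. by rewrite /det /=; ring. Qed.

Lemma detDr u v w : det u (v + w) = det u v + det u w.
Proof. by rewrite /det /=; ring. Qed.

Lemma det_mulrnr u v n : det u (v *+ n) = det u v *+ n.
Proof.
elim: n => [|n IHn]; first by rewrite !mulr0n /det /=; ring.
by rewrite !mulrSr detDr IHn.
Qed.

(** As [det a b = 1], Cramer's rule gives [det c b] and [det a c] as the coordinates of [c] in the
    basis [a], [b]. *)
Lemma det_triangle a b c :
  det a b = 1 -> det a c = 1 -> det c b = 1 -> c = a + b.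
Proof.
case: a b c => [a1 a2] [b1 b2] [c1 c2]; rewrite /det /= => ab ac cb.
congr (_, _) => /=.
- transitivity (c1 * (a1 * b2 - a2 * b1)); first by rewrite ab mulr1.
  transitivity (a1 * (c1 * b2 - c2 * b1) + b1 * (a1 * c2 - a2 * c1)); first by ring.
  by rewrite cb ac !mulr1.
transitivity (c2 * (a1 * b2 - a2 * b1)); first by rewrite ab mulr1.
transitivity (a2 * (c1 * b2 - c2 * b1) + b2 * (a1 * c2 - a2 * c1)); first by ring.
by rewrite cb ac !mulr1.
Qed.

(** * Triangulated polygons and their unimodular frames *)

(* The existence of an apex stands for the maximality of the set of diagonals. *)
Record polygon_triangulation (N : nat) (E : rel nat) : Prop := PolygonTriangulation {
  pt_sym : symmetric E;
  pt_irr : irreflexive E;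
  pt_side : forall k, (k.+1 < N)%N -> E k k.+1;
  pt_noncrossing : forall x y z w, (x < y < z)%N -> (z < w < N)%N ->
    E x z -> E y w -> False;
  pt_apex : forall a b, (a.+1 < b < N)%N -> E a b ->
    exists2 c, (a < c < b)%N & E a c && E c b }.

(** An edge with [c] strictly between its ends crosses [ac] unless it starts at [a]; starting at
    [a], it crosses [cb] unless it ends at [b]. *)
Lemma apex_separates N E a b c x y : polygon_triangulation N E ->
  (a < c < b)%N -> (b < N)%N -> E a c -> E c b ->
  (a <= x < y)%N -> (y <= b)%N -> E x y ->
  [|| (y <= c)%N, (c <= x)%N | (x == a) && (y == b)].
Proof.
move=> HE acb bN Eac Ecb axy yb Exy.
case: (leqP y c) => //= cy; case: (leqP c x) => //= xc.
have {}axy : (a <= x)%N by lia.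
apply/andP; split; apply/eqP.
- apply/eqP/negPn/negP => xa.
  by apply: (pt_noncrossing HE (x := a) (y := x) (z := c) (w := y)) => //; lia.
- case: (ltnP y b) => [ybl|]; last by lia.
  have xa : x = a.
    apply/eqP/negPn/negP => xa.
    by apply: (pt_noncrossing HE (x := a) (y := x) (z := c) (w := y)) => //; lia.
  exfalso; apply: (pt_noncrossing HE (x := a) (y := c) (z := y) (w := b)) => //; try lia.
  by rewrite -xa.
Qed.

(** Induction on the gap: the apex gets [A + B], which has determinant 1 with [A] and with [B], and
    the frames of the two halves are glued there. *)
Lemma polygon_frame N E a b A B : polygon_triangulation N E ->
  (a < b < N)%N -> E a b -> det A B = 1 ->
  exists V : nat -> int * int,
    [/\ V a = A, V b = B,
        forall x y, (a <= x < y)%N -> (y <= b)%N -> E x y -> det (V x) (V y) = 1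
      & forall x y, (a <= x < y)%N -> (y <= b)%N -> 0 < det (V x) (V y)].
Proof.
move=> HE; have [n] := ubnP (b - a)%N.
elim: n a b A B => // n IHn a b A B lt_n ab Eab AB.
have [bE|ba] := eqVneq b a.+1.
  exists (fun k => if k == a then A else B).
  have H x y : (a <= x < y)%N -> (y <= b)%N -> x = a /\ y = b by lia.
  split; [by rewrite eqxx| by rewrite bE eq_sym; case: eqP => //; lia| |];
  by move=> x y h1 h2; have [-> ->] := H _ _ h1 h2;
     rewrite eqxx (_ : (b == a) = false) ?AB //; lia.
have [|c acb /andP[Eac Ecb]] := pt_apex HE _ Eab; first by lia.
have [||||V [Va Vc V1 V0]] := IHn a c A (A + B); try lia; try done.
  by rewrite detDr detxx AB.
have [||||W [Wc Wb W1 W0]] := IHn c b (A + B) B; try lia; try done.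
  by rewrite detDl detxx AB.
pose U k := if (k <= c)%N then V k else W k.
have UV x : (x <= c)%N -> U x = V x by rewrite /U => ->.
have UW x : (c <= x)%N -> U x = W x.
  by rewrite /U; case: (leqP x c) => // xc cx; rewrite (_ : x = c) ?Vc ?Wc //; lia.
have Ua : U a = A by rewrite UV //; lia.
have Ub : U b = B by rewrite UW //; lia.
have Uc : U c = A + B by rewrite UV.
exists U; split=> // x y axy yb.
  move=> Exy.
  have /or3P[yc|cx|/andP[/eqP-> /eqP->]] :=
    apex_separates HE acb (proj2 (andP ab)) Eac Ecb axy yb Exy.
  - by rewrite !UV; [apply: V1; lia|lia|lia].
  - by rewrite !UW; [apply: W1; lia|lia|lia].
  - by rewrite Ua Ub.
case: (leqP y c) => [yc|cy]; first by rewrite !UV; [apply: V0; lia|lia|lia].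
case: (leqP c x) => [cx|xc]; first by rewrite !UW; [apply: W0; lia|lia|lia].
have xc0 : 0 < det (U x) (U c) by rewrite !UV; [apply: V0; lia|lia|lia].
have cy0 : 0 < det (U c) (U y) by rewrite !UW; [apply: W0; lia|lia|lia].
have ax0 : 0 <= det A (U x).
  rewrite -Ua; have [->|xa] := eqVneq x a; first by rewrite detxx.
  by rewrite ltW // !UV; [apply: V0; lia|lia|lia].
have yb0 : 0 <= det (U y) B.
  rewrite -Ub; have [->|yb'] := eqVneq y b; first by rewrite detxx.
  by rewrite ltW // !UW; [apply: W0; lia|lia|lia].
(* The middle product is positive; the outer ones may vanish, when [y = b] or [x = a]. *)
have -> : det (U x) (U y) = det (U x) (U c) * det (U y) B
    + det (U x) (U c) * det (U c) (U y) + det A (U x) * det (U c) (U y).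
  by rewrite -[LHS]mulr1 -{1}AB Uc /det /=; ring.
by rewrite -addrA ltr_wpDl ?mulr_ge0 ?ltr_wpDr ?mulr_gt0 ?mulr_ge0 // ltW.
Qed.

(** * Counting triangles, and friese numbers as determinants *)

Definition tri_count (E : rel nat) (N a b l : nat) : nat :=
  \sum_(j < N) \sum_(k < N)
    [&& (a <= l <= b)%N, (a <= j < k)%N, (k <= b)%N, E l j, E l k & E j k].

Lemma sum_pair_delta N (P : bool) x y : (x < N)%N -> (y < N)%N ->
  (\sum_(j < N) \sum_(k < N) [&& P, j == x :> nat & k == y :> nat])%N = P :> nat.
Proof.
move=> xN yN.
rewrite (bigD1 (Ordinal xN)) //= (bigD1 (Ordinal yN)) //= !eqxx !andbT.
rewrite big1 => [|k /negPf]; last by rewrite -val_eqE /= => ->; rewrite !andbF.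
rewrite big1 ?addn0 // => j /negPf; rewrite -val_eqE /= => jx.
by rewrite big1 // => k _; rewrite jx andbF.
Qed.

(** Every triangle lies before [c], lies after [c], or is [abc]; the last three terms count [abc] at
    its own corners. *)
Lemma tri_count_split N E a b c l : polygon_triangulation N E ->
  (a < c < b)%N -> (b < N)%N -> E a b -> E a c -> E c b ->
  tri_count E N a b l =
    (tri_count E N a c l + tri_count E N c b l + (l == a) + (l == b) + (l == c))%N.
Proof.
move=> HE acb bN Eab Eac Ecb.
have aN : (a < N)%N by lia.
have cN : (c < N)%N by lia.
rewrite -(@sum_pair_delta N (l == a) c b) // -(@sum_pair_delta N (l == b) a c) //.
rewrite -(@sum_pair_delta N (l == c) a b) // -!big_split /=.
apply: eq_bigr => -[j jN] _; rewrite -!big_split /=; apply: eq_bigr => -[k kN] _ /=.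
case: (boolP [&& E l j, E l k & E j k]) => [/and3P[lj lk jk]|nE].
  rewrite !andbT; have neq x y : E x y -> x <> y by move=> + e; rewrite e (pt_irr HE).
  case: (boolP [&& (a <= l <= b)%N, (a <= j < k)%N & (k <= b)%N]); last first.
    move=> out; apply/esym/eqP; rewrite !addn_eq0 !eqb0 -!andbA.
    by apply/and5P; split; apply: contra out; clear -acb; lia.
  (* The trichotomy for a triangle with sorted corners; [l] may stand before, between or after [j]
     and [k], so it is used in three ways below. *)
  have sep x y z : E x y -> E x z -> E y z -> (a <= x)%N -> (x < y < z)%N -> (z <= b)%N ->
    [|| (z <= c)%N, (c <= x)%N | [&& x == a, y == c & z == b]].
    move=> xy xz yz ax xyz zb.
    have := apex_separates HE acb bN Eac Ecb _ _ xy.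
    have := apex_separates HE acb bN Eac Ecb _ _ xz.
    have := apex_separates HE acb bN Eac Ecb _ _ yz.
    by clear -ax xyz zb; lia.
  have [l_j l_k] := (neq _ _ lj, neq _ _ lk).
  move=> /and3P[alb ajk kb].
  have [o|[o|o]] : (l < j)%N \/ (j < l < k)%N \/ (k < l)%N by clear -l_j l_k ajk; lia.
  - have := sep l j k lj lk jk; clear -alb ajk kb o acb; lia.
  - rewrite (pt_sym HE) in lj; have := sep j l k lj jk lk; clear -alb ajk kb o acb; lia.
  - rewrite (pt_sym HE) in lj; rewrite (pt_sym HE) in lk.
    by have := sep j k l jk lj lk; clear -alb ajk kb o acb; lia.
rewrite !andbF.
have J1 : [&& l == a, j == c & k == b] = false.
  by apply: contraNF nE => /and3P[/eqP-> /eqP-> /eqP->]; rewrite Eac Eab Ecb.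
have J2 : [&& l == b, j == a & k == c] = false.
  by apply: contraNF nE => /and3P[/eqP-> /eqP-> /eqP->]; rewrite !(pt_sym HE b) Eac Eab Ecb.
have J3 : [&& l == c, j == a & k == b] = false.
  by apply: contraNF nE => /and3P[/eqP-> /eqP-> /eqP->]; rewrite (pt_sym HE c a) Eac Eab Ecb.
by rewrite J1 J2 J3.
Qed.

Lemma tri_count_out N E a b l : ~~ (a <= l <= b)%N -> tri_count E N a b l = 0%N.
Proof. by move=> /negPf H; rewrite /tri_count big1 // => j _; rewrite big1 // => k _; rewrite H. Qed.

Lemma tri_count_edge N E a l : polygon_triangulation N E -> tri_count E N a a.+1 l = 0%N.
Proof.
move=> HE; rewrite /tri_count big1 // => j _; rewrite big1 // => k _.
apply/eqP; rewrite eqb0; apply/negP => /and5P[h1 h2 h3 h4 /andP[h5 _]].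
have [lj|lk] : l = j \/ l = k by lia.
- by move: h4; rewrite lj (pt_irr HE).
- by move: h5; rewrite lk (pt_irr HE).
Qed.

(** Induction over the apex [c]: in the relations at [a] and [b], the triangle [abc] replaces [V c]
    by [V a + V b]; at [c], the end relations of the two halves add up to the inner one. *)
Lemma frame_recurrence N E (V : nat -> int * int) a b : polygon_triangulation N E ->
  (forall x y, (x < y < N)%N -> E x y -> det (V x) (V y) = 1) ->
  (a < b < N)%N -> E a b ->
  [/\ V a.+1 = V a *+ tri_count E N a b a + V b,
      V b.-1 = V a + V b *+ tri_count E N a b b
    & forall l, (a < l < b)%N -> V l.-1 + V l.+1 = V l *+ tri_count E N a b l].
Proof.
move=> HE V1; have [n] := ubnP (b - a)%N.
elim: n a b => // n IHn a b lt_n ab Eab.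
have [bE|ba] := eqVneq b a.+1.
  by rewrite bE !(tri_count_edge _ _ HE) !mulr0n addr0 add0r; split=> // l; lia.
have [|c acb /andP[Eac Ecb]] := pt_apex HE _ Eab; first by lia.
have [|||a1 a2 a3] := IHn a c; try lia; try done.
have [|||b1 b2 b3] := IHn c b; try lia; try done.
have Vc : V c = V a + V b.
  by apply: det_triangle; apply: V1 => //; lia.
have split l := tri_count_split l HE acb (proj2 (andP ab)) Eab Eac Ecb.
have F x y : (x < y)%N -> ((x == y) = false) * ((y == x) = false) by move=> xy; split; lia.
have [ac cb] := andP acb; have {}ab := proj1 (andP ab).
split.
- rewrite split eqxx (F a b ab) (F a c ac) (@tri_count_out N E c b a); last by lia.
  by rewrite !addn0 addn1 mulrSr a1 Vc addrA.
- rewrite split eqxx (F a b ab) (F c b cb) (@tri_count_out N E a c b); last by lia.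
  by rewrite add0n !addn0 addn1 mulrS b2 Vc addrA.
move=> l alb; rewrite split; have [al lb] := andP alb; rewrite (F a l al) (F l b lb).
have [->|[lc|lc]] : l = c \/ (l < c)%N \/ (c < l)%N by lia.
- rewrite eqxx a2 b1 !addn0 addn1 mulrSr mulrnDr.
  by rewrite [V a + _]addrC addrACA -Vc.
- rewrite (F l c lc) (@tri_count_out N E c b l); last by lia.
  by rewrite !addn0 a3 //; lia.
- rewrite (F c l lc) (@tri_count_out N E a c l); last by lia.
  by rewrite !addn0 add0n b3 //; lia.
Qed.

(** For fixed [k], the determinants start with 0, 1 and obey the recurrence that defines the friese
    numbers. As [k < l], only inner vertices are passed and indices never wrap around. *)
Lemma friese_det N E (V : nat -> int * int) (f : nat -> int) k l :
  polygon_triangulation N E ->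
  (forall x y, (x < y < N)%N -> E x y -> det (V x) (V y) = 1) ->
  E 0%N N.-1 -> (forall m, (m < N)%N -> f m = (tri_count E N 0 N.-1 m)%:Z) ->
  (k < l < N)%N -> friese f N k l = det (V k) (V l).
Proof.
move=> HE V1 E0 fE klN.
have mE t : (k + t.+1 < N)%N ->
    mpair f N k t = (det (V k) (V (k + t)%N), det (V k) (V (k + t.+1)%N)).
  elim: t => [|t IHt] ktN /=.
    rewrite addn0 addn1 detxx V1 //; first by lia.
    by apply: (pt_side HE); lia.
  rewrite IHt; last by lia.
  rewrite -addnS modn_small; last by lia.
  congr (_, _).
  have [|_ _ rec] := @frame_recurrence N E V 0 N.-1 HE V1 _ E0; first by lia.
  have /esym := rec (k + t.+1)%N ltac:(lia).
  rewrite fE; last by lia.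
  have -> : (k + t.+1).-1 = (k + t)%N by lia.
  have -> : (k + t.+1).+1 = (k + t.+2)%N by lia.
  move=> /(congr1 (det (V k))); rewrite det_mulrnr detDr => recE.
  by rewrite -mulr_natl natz in recE; rewrite recE addrC addKr.
have -> : friese f N k l = (mpair f N k (l - k)%N).1.
  by rewrite /friese; congr (mpair f N k _).1; rewrite -addnBAC; [rewrite modnDr modn_small //; lia|lia].
case: (posnP (l - k)%N) => [|lk]; first by lia.
case E': (l - k)%N lk => [|m] // _ /=; rewrite mE; last by lia.
by rewrite /=; congr (det (V k) (V _)); lia.
Qed.

(** * Boundary order of the strip *)

Definition arc_of (u v : vert) : Defs.arc :=
  match u, v with
  | Up a, Up b => UpA a b
  | Dn a, Dn b => DnA a b
  | Up a, Dn b => Conn a b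
  | Dn b, Up a => Conn a b
  end.

(** The edges are numbered in opposite directions, so this is the order of a walk along the upper
    edge and back along the lower one. It turns crossing into interlacing, as [crosses_arc_of]
    shows. *)
Definition vlt (u v : vert) : bool :=
  match u, v with
  | Up a, Up b => a < b
  | Dn a, Dn b => a < b
  | Up _, Dn _ => true
  | Dn _, Up _ => false
  end.

Definition vside (u v : vert) : bool :=
  match u, v with
  | Up a, Up b => b == a + 1
  | Dn a, Dn b => b == a + 1
  | _, _ => false
  end.

(** Segments between neighbours on an edge of the strip are not arcs, but they are sides of
    polygons. *)
Definition vadj (T : Defs.arc -> bool) (u v : vert) : bool :=
  T (arc_of u v) || vside u v.

Definition inside (p q r s : int) (v : vert) : bool :=
  match v with Up a => p <= a <= r | Dn b => s <= b <= q end.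

Lemma Conn_crossE (p q p' q' : int) :
  (0 < (p - p') * (q - q')) = (p < p') && (q < q') || (p' < p) && (q' < q).
Proof.
have [pp|pp|->] := ltgtP p p'; last by rewrite subrr mul0r ltxx.
- by rewrite nmulr_rgt0 ?subr_lt0 //= orbF.
- by rewrite pmulr_rgt0 ?subr_gt0.
Qed.

Lemma crosses_arc_of u v x y : vlt u v -> vlt x y ->
  crosses (arc_of u v) (arc_of x y) =
    [&& vlt u x, vlt x v & vlt v y] || [&& vlt x u, vlt u y & vlt y v].
Proof.
case: u v x y => [a|a] [b|b] [c|c] [d|d] //= ab cd; rewrite ?Conn_crossE; lia.
Qed.

Lemma valid_arc_of x : valid_arc x -> exists u v, vlt u v /\ x = arc_of u v.
Proof.
case: x => a b /= ab.
- by exists (Up a), (Dn b).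
- by exists (Up a), (Up b); split => //=; lia.
- by exists (Dn a), (Dn b); split => //=; lia.
Qed.

Lemma arc_of_valid u v : vlt u v -> vside u v = false -> valid_arc (arc_of u v).
Proof. by case: u v => [a|a] [b|b] //=; lia. Qed.

Lemma arc_of_inj u v x y : vlt u v -> vlt x y ->
  arc_of u v = arc_of x y -> u = x /\ v = y.
Proof. by case: u v x y => [a|a] [b|b] [c|c] [d|d] //= _ _ [-> ->]. Qed.

(* The vertices of a crossing arc cannot escape: it would cross one of the two bounding arcs. *)
Lemma crossing_inside p q r s u v x y : p <= r -> s <= q ->
  inside p q r s u -> inside p q r s v -> vlt u v -> vlt x y ->
  crosses (arc_of u v) (arc_of x y) ->
  ~~ crosses (arc_of x y) (Conn p q) -> ~~ crosses (arc_of x y) (Conn r s) ->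
  inside p q r s x && inside p q r s y.
Proof.
by case: u v x y => [a|a] [b|b] [c|c] [d|d] //= pr sq; rewrite ?Conn_crossE; lia.
Qed.

(** * The polygon cut off by two connecting arcs *)

Definition vindex (p r s : int) (v : vert) : nat :=
  match v with Up a => absz (a - p) | Dn b => (nup p r + absz (b - s))%N end.

Lemma pvert0 p r s : p < r -> pvert p r s 0 = Up p.
Proof. by move=> pr; rewrite /pvert ifT ?addr0 // /nup; lia. Qed.

Lemma pvert_corner p r s : p < r ->
  pvert p r s (nup p r).-1 = Up r /\ pvert p r s (nup p r) = Dn s.
Proof.
move=> pr; split; rewrite /pvert; [rewrite ifT|rewrite ifF]; rewrite /nup; try lia;
by [congr Up; lia|congr Dn; lia].
Qed.

Section Polygon.
Variables p q r s : int.
Hypotheses (pr : p < r) (sq : s < q).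
Let N := pN p q r s.

Lemma vindex_lt v : inside p q r s v -> (vindex p r s v < N)%N.
Proof. by case: v => a /=; rewrite /N /pN /nup; lia. Qed.

Lemma pvert_vindex v : inside p q r s v -> pvert p r s (vindex p r s v) = v.
Proof.
case: v => a /= h; rewrite /pvert /nup.
- by rewrite ifT; [congr Up|]; lia.
- by rewrite ifF; [congr Dn|]; lia.
Qed.

Lemma pvert_inside k : (k < N)%N -> inside p q r s (pvert p r s k).
Proof. by rewrite /N /pN /pvert /nup; case: ifP => /= h1 h2; lia. Qed.

Lemma vlt_pvert k l : (k < N)%N -> (l < N)%N -> vlt (pvert p r s k) (pvert p r s l) = (k < l)%N.
Proof. by rewrite /N /pN /pvert /nup; case: ifP; case: ifP => /= h1 h2 h3 h4; lia. Qed.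

Lemma pvert_last : pvert p r s N.-1 = Dn q.
Proof. by rewrite /pvert ifF /N /pN /nup; [congr Dn|]; lia. Qed.

(** The last alternative is the side from [Up r] to [Dn s]: its indices are consecutive, but it runs
    across the strip. *)
Lemma vside_pvert k l : (k < l < N)%N ->
  (l == k.+1) = vside (pvert p r s k) (pvert p r s l) || ((k == (nup p r).-1) && (l == nup p r)).
Proof. by rewrite /N /pN /pvert /nup; case: ifP; case: ifP => /= h1 h2 h3; lia. Qed.

Variable T : Defs.arc -> bool.
Hypotheses (Tv : forall x, T x -> valid_arc x) (Tpq : T (Conn p q)) (Trs : T (Conn r s)).

(** The two sides that run across the strip are the arcs [Conn p q] and [Conn r s] of [T], so [vadj]
    sees every side. *)
Lemma padjE k l : (k < l < N)%N ->
  padj T p q r s k l = vadj T (pvert p r s k) (pvert p r s l).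
Proof.
move=> klN; have /andP[kl lN] := klN; have kN : (k < N)%N by lia.
have lt_v : vlt (pvert p r s k) (pvert p r s l) by rewrite vlt_pvert.
rewrite /padj -/N kN lN (_ : k != l) /=; last by lia.
have -> : joined T (pvert p r s k) (pvert p r s l) = T (arc_of (pvert p r s k) (pvert p r s l)).
  move: lt_v; case: (pvert p r s k) (pvert p r s l) => [a|a] [b|b] //= ab.
  - by rewrite orbC; case: (boolP (T (UpA b a))) => // /Tv /=; lia.
  - by rewrite orbC; case: (boolP (T (DnA b a))) => // /Tv /=; lia.
rewrite /vadj /pside orbC eq_sym vside_pvert //.
have -> : (l.+1 == k) = false by lia.
have -> : (l == 0%N) = false by lia.
rewrite /= !orbF.
case: (boolP ((k == 0%N) && _)) => [/andP[/eqP-> /eqP->]|_].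
  by rewrite (@pvert0 p r s pr) pvert_last /= Tpq.
case: (boolP ((k == _) && _)) => [/andP[/eqP-> /eqP->]|_].
  by have [-> ->] := @pvert_corner p r s pr; rewrite /= Trs.
by rewrite !orbF.
Qed.

Lemma padj_sym : symmetric (padj T p q r s).
Proof.
move=> k l; rewrite /padj -/N eq_sym; case: (l < N)%N; case: (k < N)%N => //=; congr (_ && _).
congr (_ || _).
  rewrite /pside; case: (k.+1 == l); case: (l.+1 == k) => //=.
  by rewrite orbC.
by case: (pvert p r s k) (pvert p r s l) => [a|a] [b|b] //=; rewrite orbC.
Qed.

End Polygon.

(** * Restricting a triangulation of the strip to a polygon *)

Lemma crossesxx x : crosses x x = false.
Proof. by case: x => a b /=; rewrite ?subrr ?mul0r ?ltxx //; lia. Qed.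

Lemma triangulation_noncrossing T x y :
  is_triangulation T -> T x -> T y -> ~~ crosses x y.
Proof.
move=> [_ [Tx _]] hx hy; case: (classic (x = y)) => [->|]; last exact: Tx.
by rewrite crossesxx.
Qed.

(* The apex is the last neighbour c of a before b: an arc crossing cb would cross ab or ac,
   unless it starts at a. *)
Lemma apex_of_maximal N (E : rel nat) a b :
  (forall k, (k.+1 < N)%N -> E k k.+1) ->
  (forall x y z w, (x < y < z)%N -> (z < w < N)%N -> E x z -> E y w -> False) ->
  (forall x y, (x.+1 < y < N)%N -> ~~ E x y ->
     exists k l, [/\ (k < l < N)%N, E k l & (x < k < y)%N && (y < l)%N || (k < x < l)%N && (l < y)%N]) ->
  (a.+1 < b < N)%N -> E a b -> exists2 c, (a < c < b)%N & E a c && E c b.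
Proof.
move=> side nc maxE abN Eab.
pose Q c := (a < c < b)%N && E a c.
have exQ : exists c, Q c by exists a.+1; rewrite /Q side; lia.
have leQ c : Q c -> (c <= b)%N by rewrite /Q; lia.
case: (ex_maxnP exQ leQ) => c /andP[acb Eac] cmax.
exists c => //; rewrite Eac /=; apply/negPn/negP => nEcb.
have cb : (c.+1 < b < N)%N.
  have : b <> c.+1 by move=> bE; move: nEcb; rewrite bE side //; clear -abN bE; lia.
  by clear -acb abN; lia.
have [k [l [klN Ekl /orP[ckl|kcl]]]] := maxE _ _ cb nEcb.
  by apply: (nc a k b l) => //; clear -acb klN ckl; lia.
have [ka|[ka|ka]] : (k < a)%N \/ (a < k)%N \/ k = a by clear; lia.
- by apply: (nc k a l b) => //; clear -acb abN kcl ka; lia.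
- by apply: (nc a k c l) => //; clear -kcl ka klN; lia.
- have : (l <= c)%N by apply: cmax; rewrite /Q -ka Ekl andbT; clear -acb kcl ka; lia.
  by clear -kcl; lia.
Qed.

(** By maximality of [T] a non-edge is crossed by an arc of [T]. That arc crosses neither bounding
    arc, so [crossing_inside] keeps it in the polygon and [apex_of_maximal] applies. *)
Lemma strip_polygon T p q r s : is_triangulation T -> p < r -> s < q ->
  T (Conn p q) -> T (Conn r s) ->
  polygon_triangulation (pN p q r s) (padj T p q r s).
Proof.
move=> HT pr sq Tpq Trs.
have [Tv [_ [Tm _]]] := HT.
have Tx x y := @triangulation_noncrossing T x y HT.
set N := pN p q r s; set P := pvert p r s; set E := padj T p q r s.
have side k : (k.+1 < N)%N -> E k k.+1.
  by move=> kN; rewrite /E /padj -/N kN ltnW //= /pside eqxx /= andbT; lia.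
have EE k l : (k < l < N)%N -> E k l = vadj T (P k) (P l) by exact: padjE.
have PP k l : (k < N)%N -> (l < N)%N -> vlt (P k) (P l) = (k < l)%N by exact: vlt_pvert.
have ET k l : (k.+1 < l < N)%N -> E k l = T (arc_of (P k) (P l)).
  move=> kl; rewrite EE ?/vadj; last by lia.
  have : (k < l < N)%N by lia.
  move=> /(vside_pvert pr sq); rewrite (_ : (l == k.+1) = false); last by lia.
  by case: vside => //; rewrite orbF.
have nc x y z w : (x < y < z)%N -> (z < w < N)%N -> E x z -> E y w -> False.
  move=> xyz zwN; rewrite !ET; [|lia..] => h1 h2.
  by have /negP[] := Tx _ _ h1 h2; rewrite crosses_arc_of !PP; lia.
split=> //; [exact: padj_sym| by move=> k; rewrite /E /padj eqxx !andbF|].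
move=> a b; apply: apex_of_maximal => // {a b} c b cb nEcb; apply/not_all_not_ex => nex.
have [cN bN] : (c < N)%N /\ (b < N)%N by clear -cb; lia.
have cb_lt : vlt (P c) (P b) by rewrite PP //; clear -cb; lia.
case/negP: nEcb; rewrite ET //; apply: Tm.
  apply: arc_of_valid => //.
  have : (c < b < N)%N by clear -cb; lia.
  move=> /(vside_pvert pr sq); rewrite (_ : (b == c.+1) = false); last by clear -cb; lia.
  by case: vside.
move=> y Ty _; apply/negP => cr.
have [u [v [uv yE]]] := valid_arc_of (Tv _ Ty); subst y.
have /andP[iu iv] : inside p q r s u && inside p q r s v.
  apply: (crossing_inside _ _ _ _ cb_lt uv cr); try exact: Tx; try exact: ltW;
  by apply: pvert_inside.
have kN := vindex_lt pr sq iu; have lN := vindex_lt pr sq iv.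
have uE := pvert_vindex pr sq iu; have vE := pvert_vindex pr sq iv.
apply: (nex (vindex p r s u)); exists (vindex p r s v).
have kl : (vindex p r s u < vindex p r s v)%N by rewrite -PP // /P uE vE.
split; first by rewrite kl.
- by rewrite EE ?kl // /P uE vE /vadj Ty.
- have c_b : (c < b)%N by clear -cb; lia.
  move: cr; rewrite -{1}uE -{1}vE -!/(P _) crosses_arc_of ?PP //.
  by rewrite -!andbA.
Qed.

(** * Frames on the strip, and independence of [Phi] from the polygon *)

Definition unimodular_on (T : Defs.arc -> bool) p q r s (V : vert -> int * int) :=
  forall u v, inside p q r s u -> inside p q r s v -> vlt u v -> vadj T u v ->
    det (V u) (V v) = 1.

Lemma padj_ends T p q r s : p < r -> s < q -> padj T p q r s 0 (pN p q r s).-1.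
Proof. by move=> pr sq; rewrite /padj /pside eqxx /= eqxx /= !orbT /pN; lia. Qed.

Lemma strip_frame T p q r s : is_triangulation T -> p < r -> s < q ->
  T (Conn p q) -> T (Conn r s) ->
  exists2 V, unimodular_on T p q r s V &
    forall u v, inside p q r s u -> inside p q r s v -> vlt u v -> 0 < det (V u) (V v).
Proof.
move=> HT pr sq Tpq Trs; have HE := strip_polygon HT pr sq Tpq Trs.
have N0 : (0 < (pN p q r s).-1 < pN p q r s)%N by rewrite /pN; lia.
have [|W [_ _ W1 W0]] := @polygon_frame _ _ 0%N _ (1, 0) (0, 1) HE N0 (padj_ends T pr sq).
  by rewrite /det /=; ring.
have [Tv _] := HT.
have lt_index u v : inside p q r s u -> inside p q r s v -> vlt u v ->
    (vindex p r s u < vindex p r s v < pN p q r s)%N.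
  move=> iu iv; rewrite -{1}(@pvert_vindex p q r s pr sq u iu) -{1}(@pvert_vindex p q r s pr sq v iv).
  by rewrite (vlt_pvert pr sq) ?vindex_lt // => ->.
exists (fun v => W (vindex p r s v)) => u v iu iv uv; have kl := lt_index _ _ iu iv uv.
- move=> a_uv; apply: W1; [lia|lia|].
  by rewrite (padjE pr sq Tv Tpq Trs kl) !(pvert_vindex pr sq).
- by apply: W0; lia.
Qed.

Lemma ntriE T p q r s l : (l < pN p q r s)%N ->
  ntri T p q r s l = (tri_count (padj T p q r s) (pN p q r s) 0 (pN p q r s).-1 l)%:Z.
Proof.
move=> lN; congr Posz; apply: eq_bigr => -[j jN] _; apply: eq_bigr => -[k kN] _ /=.
have [-> ->] : (l <= (pN p q r s).-1)%N /\ (k <= (pN p q r s).-1)%N by clear -lN kN; lia.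
by [].
Qed.

(** Any frame that is unimodular on the polygon computes the value, so one frame can serve several
    polygons. *)
Lemma Phi_val_det T p q r s V i j : is_triangulation T ->
  T (Conn p q) -> T (Conn r s) -> unimodular_on T p q r s V ->
  p < i < r -> s < j < q ->
  Phi_val T p q r s i j = det (V (Up i)) (V (Dn j)).
Proof.
move=> HT Tpq Trs HV pir sjq.
have pr : p < r by lia.
have sq : s < q by lia.
have HE := strip_polygon HT pr sq Tpq Trs; have [Tv _] := HT.
have iu : inside p q r s (Up i) by rewrite /=; lia.
have iv : inside p q r s (Dn j) by rewrite /=; lia.
have := @friese_det _ _ (fun k => V (pvert p r s k)) (ntri T p q r s)
  (vindex p r s (Up i)) (vindex p r s (Dn j)) HE.
rewrite !(pvert_vindex pr sq) //; apply.
- move=> x y xyN; rewrite (padjE pr sq) // => a_xy.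
  apply: HV => //; try (apply: pvert_inside => //; lia).
  by rewrite (vlt_pvert pr sq); lia.
- exact: padj_ends.
- by move=> m; apply: ntriE.
- by rewrite vindex_lt // andbT /= /nup; lia.
Qed.

Lemma unimodular_onS T p q r s p' q' r' s' V :
  p' <= p -> r <= r' -> s' <= s -> q <= q' ->
  unimodular_on T p' q' r' s' V -> unimodular_on T p q r s V.
Proof.
move=> pp rr ss qq HV u v iu iv; apply: HV.
- by case: u iu => a /=; lia.
- by case: v iv => a /=; lia.
Qed.

Lemma Phi_choice T i j : is_triangulation T ->
  exists p q r s, [/\ T (Conn p q), T (Conn r s), p < i < r & s < j < q].
Proof.
move=> [_ [_ [_ [TL TR]]]].
have [p [q [Tpq [pi jq]]]] := TL i j; have [r [s [Trs [ir sj]]]] := TR i j.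
by exists p, q, r, s; split => //; lia.
Qed.

Lemma Phi_wd T i j p q r s : is_triangulation T -> T (Conn p q) -> T (Conn r s) ->
  p < i < r -> s < j < q -> Phi T i j = Phi_val T p q r s i j.
Proof.
move=> HT Tpq Trs pir sjq; rewrite /Phi.
have : Phi_choice_ok T i j (epsilon (inhabits (0, 0, 0, 0)) (Phi_choice_ok T i j)).
  by apply: epsilon_spec; exists (p, q, r, s).
move: (epsilon _ _) => [[[p' q'] r'] s'] ok.
have [Tpq' [Trs' [pir' sjq']]] : T (Conn p' q') /\ T (Conn r' s') /\ p' < i < r' /\ s' < j < q' by exact: ok.
have [_ [_ [_ [TL TR]]]] := HT.
(* The extreme bounds yield a polygon containing both given ones; its frame restricts to each of
   them. *)
have [P [Q [TPQ [Pp Qq]]]] := TL (Num.min p p') (Num.max q q').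
have [R [S [TRS [Rr Ss]]]] := TR (Num.max r r') (Num.min s s').
have [||V HV _] := strip_frame HT _ _ TPQ TRS; [lia|lia|].
rewrite !(@Phi_val_det T _ _ _ _ V) //; apply: unimodular_onS HV; lia.
Qed.

Lemma Phi_det T p q r s V i j : is_triangulation T ->
  T (Conn p q) -> T (Conn r s) -> unimodular_on T p q r s V ->
  p < i < r -> s < j < q -> Phi T i j = det (V (Up i)) (V (Dn j)).
Proof. by move=> HT Tpq Trs HV pir sjq; rewrite (Phi_wd HT Tpq Trs) // (Phi_val_det HT Tpq Trs HV). Qed.

Lemma wide_frame T i1 i2 j1 j2 : is_triangulation T -> i1 <= i2 -> j1 <= j2 ->
  exists p q r s V, [/\ T (Conn p q) /\ T (Conn r s), (p < i1 /\ i2 < r) /\ (s < j1 /\ j2 < q), unimodular_on T p q r s V,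
    forall u v, inside p q r s u -> inside p q r s v -> vlt u v -> 0 < det (V u) (V v)
    & forall i j, p < i < r -> s < j < q -> Phi T i j = det (V (Up i)) (V (Dn j))].
Proof.
move=> HT i12 j12; have [_ [_ [_ [TL TR]]]] := HT.
have [p [q [Tpq [pi qj]]]] := TL i1 j2; have [r [s [Trs [ri sj]]]] := TR i2 j1.
have [||V HV V0] := strip_frame HT _ _ Tpq Trs; [lia|lia|].
exists p, q, r, s, V; split=> // i j; exact: Phi_det.
Qed.

(** * SL2-tilings as tables of determinants *)

Lemma int_ind_succ (P : int -> Prop) :
  P 0 -> (forall x, P x <-> P (x + 1)) -> forall x, P x.
Proof.
move=> P0 PS; elim/int_rect => [//|n|n] IHn.
- by have := (PS _).1 IHn; rewrite -addn1 PoszD.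
- by apply/(PS _).2; rewrite -addn1 PoszD opprD subrK.
Qed.

(** By two neighbouring SL2 conditions, the quotient of the left side by [t i j] is the same for all
    [j]; the coefficient is its value at [j = 0]. *)
Lemma tiling_row_recurrence t i j : is_SL2_tiling t ->
  t (i - 1) j + t (i + 1) j =
    (t (i - 1) 0 * t (i + 1) 1 - t (i - 1) 1 * t (i + 1) 0) * t i j.
Proof.
move=> [t0 t1]; set alpha := t (i - 1) 0 * _ - _.
have tn k : t i k != 0 by rewrite gt_eqF.
pose sm k := t (i - 1) k + t (i + 1) k.
have step k : sm k * t i (k + 1) = sm (k + 1) * t i k.
  have := t1 (i - 1) k; have := t1 i k; rewrite subrK /sm => e1 e2.
  by apply/eqP; rewrite -subr_eq0; apply/eqP; move: e1 e2; lra.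
have sm0 : sm 0 = alpha * t i 0.
  have := t1 (i - 1) 0; have := t1 i 0; rewrite subrK !add0r /sm /alpha => e1 e2.
  transitivity (t (i - 1) 0 * (t i 0 * t (i + 1) 1 - t i 1 * t (i + 1) 0) +
    t (i + 1) 0 * (t (i - 1) 0 * t i 1 - t (i - 1) 1 * t i 0)); last by ring.
  by rewrite e1 e2 !mulr1.
elim/int_ind_succ: j => // k; rewrite -!/(sm _).
split=> e.
- by apply: (mulIf (tn k)); rewrite -step e; ring.
- by apply: (mulIf (tn (k + 1))); rewrite step e; ring.
Qed.

(* The pair attached to [Dn j] holds, up to sign, the coordinates of the column j of t
   in terms of its columns 0 and 1, by Cramer's rule on the rows 0 and 1. *)
Definition frame (t : int -> int -> int) (v : vert) : int * int :=
  match v with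
  | Up i => (t i 0, t i 1)
  | Dn j => (t 0 j * t 1 0 - t 1 j * t 0 0, t 0 j * t 1 1 - t 1 j * t 0 1)
  end.

(** Rows 0 and 1 agree by the SL2 condition at (0, 0). Both sides obey the row recurrence, so the
    induction carries two consecutive rows. *)
Lemma det_frame t i j : is_SL2_tiling t -> det (frame t (Up i)) (frame t (Dn j)) = t i j.
Proof.
move=> Ht; have [_ t1] := Ht.
have e00 := t1 0 0; rewrite !add0r in e00.
pose D i := det (frame t (Up i)) (frame t (Dn j)).
suff : D i = t i j /\ D (i + 1) = t (i + 1) j by case.
elim/int_ind_succ: i => [|i].
  rewrite add0r /D /det /=; split.
    transitivity (t 0 j * (t 0 0 * t 1 1 - t 0 1 * t 1 0)); first by ring.
    by rewrite e00 mulr1.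
  transitivity (t 1 j * (t 0 0 * t 1 1 - t 0 1 * t 1 0)); first by ring.
  by rewrite e00 mulr1.
have rec k := @tiling_row_recurrence t (i + 1) k Ht.
rewrite addrK in rec.
have r0 := rec 0; have r1 := rec 1; have rj := rec j; clear rec.
rewrite /D /det /=; move: (i + 1) (i + 1 + 1) r0 r1 rj => i1 i2 r0 r1 rj.
have rD : D i + D i2 = (t i 0 * t i2 1 - t i 1 * t i2 0) * D i1.
  transitivity ((t i 0 + t i2 0) * (frame t (Dn j)).2 - (t i 1 + t i2 1) * (frame t (Dn j)).1).
    by rewrite /D /det /=; ring.
  by rewrite r0 r1 /D /det /=; ring.
rewrite /D /det /= in rD.
split=> -[e1 e2]; split=> //.
- by apply: (addrI (t i j)); rewrite rj -e2 -rD e1.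
- by apply: (addIr (t i2 j)); rewrite rj -e1 -rD e2.
Qed.

(** The quotient [g i / f i] is strictly increasing; the induction step expresses this with
    denominators cleared by [f c]. *)
Lemma minor_pos (f g : int -> int) (a b : int) : (forall i, 0 < f i) -> (forall i, 0 < g i) ->
  (forall i, f i * g (i + 1) - g i * f (i + 1) = 1) -> a < b ->
  0 < f a * g b - g a * f b.
Proof.
move=> f0 g0 fg ab.
have -> : b = a + 1 + (absz (b - a - 1)%R)%:Z by lia.
elim: absz => [|n IHn]; first by rewrite addr0 fg.
have -> : a + 1 + n.+1%:Z = a + 1 + n%:Z + 1 by lia.
set c := a + 1 + n%:Z in IHn *.
rewrite -(pmulr_lgt0 _ (f0 c)).
have -> : (f a * g (c + 1) - g a * f (c + 1)) * f c =
    (f a * g c - g a * f c) * f (c + 1) + (f c * g (c + 1) - g c * f (c + 1)) * f a by ring.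
by rewrite fg mul1r addr_gt0 ?mulr_gt0.
Qed.

Lemma det_frame_Up t a b :
  det (frame t (Up a)) (frame t (Up b)) = t a 0 * t b 1 - t a 1 * t b 0.
Proof. by []. Qed.

Lemma det_frame_Dn t a b : is_SL2_tiling t ->
  det (frame t (Dn a)) (frame t (Dn b)) = t 0 a * t 1 b - t 1 a * t 0 b.
Proof.
move=> [_ t1]; have e00 := t1 0 0; rewrite !add0r in e00.
transitivity ((t 0 0 * t 1 1 - t 0 1 * t 1 0) * (t 0 a * t 1 b - t 1 a * t 0 b)).
  by rewrite /det /=; ring.
by rewrite e00 mul1r.
Qed.

Lemma frame_pos t u v : is_SL2_tiling t -> vlt u v -> 0 < det (frame t u) (frame t v).
Proof.
move=> Ht; have [t0 t1] := Ht.
case: u v => [a|a] [b|b] // ab; first last.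
- rewrite det_frame_Dn //; apply: minor_pos ab => // i.
  by have := t1 0 i; rewrite add0r; lra.
- by rewrite det_frame.
- by apply: (@minor_pos (t^~ 0) (t^~ 1)) ab => // i; apply: t1.
Qed.

Lemma frame_side t u v : is_SL2_tiling t -> vside u v -> det (frame t u) (frame t v) = 1.
Proof.
move=> Ht; have [_ t1] := Ht; case: u v => [a|a] [b|b] //= /eqP ->.
- by have := t1 a 0; rewrite add0r /det /=; lra.
- by rewrite det_frame_Dn //; have := t1 0 a; rewrite add0r; lra.
Qed.

(** * Edges of determinant 1 in a positive polygon *)

Lemma unit_apex (V : nat -> int * int) a b : (a.+1 < b)%N ->
  (forall k, (a <= k < b)%N -> det (V k) (V k.+1) = 1) ->
  (forall x y, (a <= x < y)%N -> (y <= b)%N -> 0 < det (V x) (V y)) ->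
  det (V a) (V b) = 1 ->
  exists2 c, (a < c < b)%N & det (V a) (V c) = 1 /\ det (V c) (V b) = 1.
Proof.
move=> ab side pos Vab.
(* f x and g x are the coordinates of V x in the basis (V a, V b); g - f changes sign between
   a and b, and can only do so through a vertex with f = g = 1. *)
pose f x := det (V x) (V b); pose g x := det (V a) (V x).
pose Q x := (a <= x < b)%N && (g x <= f x).
have exQ : exists x, Q x by exists a; rewrite /Q /f /g detxx Vab; lia.
have leQ x : Q x -> (x <= b)%N by rewrite /Q; lia.
case: (ex_maxnP exQ leQ) => x /andP[axb gf] xmax.
have gf1 : f x.+1 < g x.+1.
  case: (ltngtP x.+1 b) => [xb|bx|->]; [|lia|by rewrite /f /g detxx Vab].
  by rewrite ltNge; apply/negP => h; have := xmax x.+1; rewrite /Q h; lia.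
have fg : f x * g x.+1 - g x * f x.+1 = 1.
  by rewrite -(side x axb) -[RHS]mulr1 -[X in _ = _ * X]Vab /f /g /det; ring.
have f0 : 0 < f x by apply: pos; lia.
have g0 : 0 <= g x.
  by have [->|xa] := eqVneq x a; [rewrite /g detxx|apply/ltW/pos; lia].
have f1 : 0 <= f x.+1.
  by have [->|xb] := eqVneq x.+1 b; [rewrite /f detxx|apply/ltW/pos; lia].
(* In the equal case [fg] makes [f x] a divisor of 1, so [x] is the apex. Otherwise the two strict
   inequalities force [g x = f x.+1 = 0], that is [x = a] and [x.+1 = b], against [ab]. *)
have [e|gx] : f x = g x \/ g x < f x by lia.
  have fx1 : f x = 1 by clear -fg e f0 gf1; nia.
  exists x; last by rewrite -/(f x) -/(g x) -e.
  have : x <> a by move=> xa; move: e; rewrite fx1 xa /g detxx.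
  lia.
have [gx0 fx0] : g x = 0 /\ f x.+1 = 0 by clear -fg gf1 g0 f1 gx; nia.
have xa : x = a.
  by apply/eqP/negPn/negP => xa; have := pos a x; rewrite -/(g x) gx0; lia.
by have := pos x.+1 b; rewrite -/(f x.+1) fx0; lia.
Qed.

(** Induction over the apex [c]: if [k] and [l] lie on the same side of [c], recurse there;
    otherwise [kl] is crossed by [cb] when [k = a], and by [ac] when not. *)
Lemma unit_crossing (V : nat -> int * int) a b k l :
  (forall k, (a <= k < b)%N -> det (V k) (V k.+1) = 1) ->
  (forall x y, (a <= x < y)%N -> (y <= b)%N -> 0 < det (V x) (V y)) ->
  det (V a) (V b) = 1 -> (a <= k)%N -> (k.+1 < l <= b)%N -> det (V k) (V l) <> 1 ->
  exists x y, [/\ (a <= x < y)%N, (y <= b)%N, det (V x) (V y) = 1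
    & (k < x < l)%N && (l < y)%N || (x < k < y)%N && (y < l)%N].
Proof.
have [n] := ubnP (b - a)%N; elim: n a b => // n IHn a b lt_n side pos Vab ak klb Vkl.
have ab : (a.+1 < b)%N by clear -ak klb; lia.
have [c acb [Vac Vcb]] := unit_apex ab side pos Vab.
have [ck|kc] := leqP c k.
  have [|||x [y [h1 h2 h3 h4]]] := IHn c b _ _ _ Vcb ck klb Vkl.
  - by clear -lt_n acb; lia.
  - by move=> m mb; apply: side; clear -mb acb; lia.
  - by move=> x y h1 h2; apply: pos => //; clear -h1 acb; lia.
  by exists x, y; split=> //; clear -h1 acb; lia.
have [lc|cl] := leqP l c.
  have [||||x [y [h1 h2 h3 h4]]] := IHn a c _ _ _ Vac ak _ Vkl.
  - by clear -lt_n acb; lia.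
  - by move=> m mb; apply: side; clear -mb acb; lia.
  - by move=> x y h1 h2; apply: pos => //; clear -h2 acb; lia.
  - by clear -klb lc; lia.
  by exists x, y; split=> //; clear -h2 acb; lia.
have [ka|ka] := eqVneq k a.
  have lb : l != b by apply/eqP => lb; apply: Vkl; rewrite ka lb.
  by exists c, b; split=> //; clear -lb klb acb kc cl; lia.
by exists a, c; split=> //; clear -ka ak klb acb kc cl; lia.
Qed.

(** * The arcs of determinant 1 form a triangulation *)

Definition ends (x : Defs.arc) : vert * vert :=
  match x with
  | Conn a b => (Up a, Dn b)
  | UpA a b => (Up a, Up b)
  | DnA a b => (Dn a, Dn b)
  end.

Lemma ends_arc_of u v : vlt u v -> ends (arc_of u v) = (u, v).
Proof. by case: u v => [a|a] [b|b]. Qed.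

Definition unit_arcs (t : int -> int -> int) (x : Defs.arc) : bool :=
  valid_arc x && (det (frame t (ends x).1) (frame t (ends x).2) == 1).

(** The Pluecker relation writes the product of the two determinants as a sum of two products of
    positive integers, which is at least 2. *)
Lemma crossing_det (V : vert -> int * int) (I : vert -> bool) u v x y :
  (forall u v, I u -> I v -> vlt u v -> 0 < det (V u) (V v)) ->
  I u -> I v -> I x -> I y -> vlt u v -> vlt x y ->
  crosses (arc_of u v) (arc_of x y) ->
  det (V u) (V v) = 1 -> det (V x) (V y) = 1 -> False.
Proof.
move=> pos.
have H u' v' x' y' : I u' -> I v' -> I x' -> I y' ->
    [&& vlt u' x', vlt x' v' & vlt v' y'] ->
    det (V u') (V v') = 1 -> det (V x') (V y') = 1 -> False.
  move=> iu iv ix iy /and3P[ux xv vy] e1 e2.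
  have := det_plucker (V u') (V x') (V v') (V y'); rewrite e1 e2.
  have := pos _ _ iu ix ux; have := pos _ _ ix iv xv; have := pos _ _ iv iy vy.
  have uy : vlt u' y'.
    by move: ux xv vy; case: u' x' v' y' {iu iv ix iy e1 e2} => [?|?] [?|?] [?|?] [?|?] //=; lia.
  have := pos _ _ iu iy uy; move: (det _ _) (det _ _) (det _ _) (det _ _) => a b c d.
  by nia.
move=> iu iv ix iy uv xy; rewrite crosses_arc_of // => /orP[h|h] e1 e2.
- exact: (H u v x y).
- exact: (H x y u v).
Qed.

Lemma unit_arcs_triangulation t : is_SL2_tiling t -> enough_ones t ->
  is_triangulation (unit_arcs t).
Proof.
move=> Ht ones.
have pos u v : vlt u v -> 0 < det (frame t u) (frame t v) by exact: frame_pos.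
have ConnE p q : unit_arcs t (Conn p q) = (t p q == 1).
  by rewrite /unit_arcs det_frame.
split; first by move=> x /andP[].
split.
  move=> x y /andP[xv /eqP dx] /andP[yv /eqP dy] _; apply/negP => cr.
  have [u [v [uv xE]]] := valid_arc_of xv; have [z [w [zw yE]]] := valid_arc_of yv.
  subst x y; rewrite !ends_arc_of // in dx dy.
  by apply: (@crossing_det (frame t) xpredT u v z w) => // u' v' _ _; apply: pos.
split; last first.
  split=> i j; have [[p [q [h1 [h2 h3]]]] [r [s [h4 [h5 h6]]]]] := ones i j.
  - by exists p, q; rewrite ConnE h3.
  - by exists r, s; rewrite ConnE h6.
move=> x xv nx; have [u [v [uv xE]]] := valid_arc_of xv; subst x.
rewrite /unit_arcs xv ends_arc_of //=.
pose cd w := match w with Up a => absz a | Dn a => absz a end.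
(* [m] bounds the positions of [u] and [v], so ones of [t] beyond it on both sides cut off a polygon
   containing them. *)
pose m := (cd u + cd v)%:Z.
have [[p [q [pm [mq tpq]]]] _] := ones (- m) m.
have [_ [r [s [mr [sm trs]]]]] := ones m (- m).
have pr : p < r by clear -pm mr; lia.
have sq : s < q by clear -sm mq; lia.
have iu : inside p q r s u.
  by rewrite /m in pm mq mr sm *; clear -pm mq mr sm; case: u pm mq mr sm => a /=; lia.
have iv : inside p q r s v.
  by rewrite /m in pm mq mr sm *; clear -pm mq mr sm; case: v pm mq mr sm => a /=; lia.
have kN := vindex_lt pr sq iu; have lN := vindex_lt pr sq iv.
have uE := pvert_vindex pr sq iu; have vE := pvert_vindex pr sq iv.
move: (vindex p r s u) (vindex p r s v) kN lN uE vE => k l kN lN uE vE.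
set N := pN p q r s in kN lN; pose P := pvert p r s.
have PP k' l' : (k' < N)%N -> (l' < N)%N -> vlt (P k') (P l') = (k' < l')%N.
  exact: vlt_pvert.
have kl : (k < l)%N by rewrite -PP // /P uE vE.
have sideE k' l' : (k' < l' < N)%N ->
    (l' == k'.+1) = vside (P k') (P l') || ((k' == (nup p r).-1) && (l' == nup p r)).
  exact: vside_pvert.
(* The only such side off the edges of the strip is [Conn r s], which is a one of [t]. *)
have side k' : (0 <= k' < N.-1)%N -> det (frame t (P k')) (frame t (P k'.+1)) = 1.
  move=> kN'; have := sideE k' k'.+1; rewrite eqxx => /(_ ltac:(clear -kN'; lia)) /esym.
  case/orP => [|/andP[/eqP -> /eqP ->]]; first exact: frame_side.
  by rewrite /P; have [-> ->] := @pvert_corner p r s pr; rewrite det_frame.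
have [lk|kl1] : l = k.+1 \/ (k.+1 < l)%N by clear -kl; lia.
  by rewrite -uE -vE -!/(P _) lk side //; clear -lN lk; lia.
apply/eqP; apply: NNPP => duv.
(* The closing edge of the whole polygon is [Conn p q], again a one of [t]; the crossing edge found
   here will contradict [nx]. *)
have [||||||x [y [xy yN dxy cr]]] := @unit_crossing (frame t \o P) 0%N N.-1 k l _ _ _ _ _ _.
- by move=> k' /side.
- by move=> x y xy yN; apply: pos; rewrite PP; clear -xy yN lN; lia.
- by rewrite /= /P (@pvert0 p r s pr) (pvert_last pr sq) det_frame.
- by [].
- by clear -kl1 lN; lia.
- by rewrite /= /P uE vE.
have [xN yN'] : (x < N)%N /\ (y < N)%N by clear -xy yN lN; lia.
have x_y : vlt (P x) (P y) by rewrite PP //; clear -xy; lia.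
have : crosses (arc_of u v) (arc_of (P x) (P y)).
  by rewrite -uE -vE -!/(P _) crosses_arc_of !PP // -?andbA in cr *.
apply/negP; apply: nx.
- rewrite /unit_arcs ends_arc_of //= dxy eqxx andbT arc_of_valid //.
  have := sideE x y; rewrite (_ : (y == x.+1) = false); last by clear -cr; lia.
  by case: vside => // /(_ ltac:(clear -xy yN'; lia)).
- move=> /(arc_of_inj uv x_y) [ux _].
  have h1 : vlt u (P x) = (k < x)%N by rewrite -uE -/(P _) PP.
  have h2 : vlt (P x) u = (x < k)%N by rewrite -uE -/(P _) PP.
  move: h1 h2 cr; rewrite -ux.
  have -> : vlt u u = false by case: (u) => a /=; rewrite ltxx.
  by clear; lia.
Qed.

(** * The image of [Phi], and its inverse [unit_arcs] *)

Lemma Phi_SL2_tiling T : is_triangulation T -> is_SL2_tiling (Phi T).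
Proof.
move=> HT; split=> i j.
  have [p [q [r [s [V [_ [[h1 h2] [h3 h4]] _ V0 VE]]]]]] := wide_frame HT (lexx i) (lexx j).
  by rewrite VE; [apply: V0 => //=|..]; lia.
have [||p [q [r [s [V [_ [[h1 h2] [h3 h4]] V1 _ VE]]]]]] := @wide_frame T i (i + 1) j (j + 1) HT; [lia|lia|].
have up : det (V (Up i)) (V (Up (i + 1))) = 1.
  by apply: V1; rewrite /vadj /= ?eqxx ?orbT //; lia.
have dn : det (V (Dn j)) (V (Dn (j + 1))) = 1.
  by apply: V1; rewrite /vadj /= ?eqxx ?orbT //; lia.
rewrite !VE; [|lia..].
by rewrite det_plucker up dn mulr1 addrK.
Qed.

Lemma Phi_Conn T p q : is_triangulation T -> T (Conn p q) -> Phi T p q = 1.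
Proof.
move=> HT Tpq.
have [p' [q' [r [s [V [_ [[h1 h2] [h3 h4]] V1 _ VE]]]]]] := wide_frame HT (lexx p) (lexx q).
by rewrite VE; [apply: V1; rewrite /vadj /= ?Tpq //|..]; lia.
Qed.

Lemma Phi_enough_ones T : is_triangulation T -> enough_ones (Phi T).
Proof.
move=> HT i j; have [_ [_ [_ [TL TR]]]] := HT.
have [p [q [Tpq [pi jq]]]] := TL i j; have [r [s [Trs [ri sj]]]] := TR i j.
by split; [exists p, q|exists r, s]; rewrite Phi_Conn.
Qed.

(** The frame built from [Phi T] alone has the same determinants as a frame [V] of [T]. By
    [crossing_det] no arc of [T] crosses an arc of determinant 1, so maximality puts the latter in
    [T]. *)
Lemma triangulation_unit_arcs T x : is_triangulation T -> T x = unit_arcs (Phi T) x.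
Proof.
move=> HT; have [Tv [_ [Tm _]]] := HT.
case: (boolP (valid_arc x)) => [xv|nv]; last first.
  by rewrite /unit_arcs (negPf nv); apply: contraNF nv => /Tv.
have [u [v [uv xE]]] := valid_arc_of xv; subst x.
rewrite /unit_arcs xv ends_arc_of //=.
pose cd w := match w with Up a => absz a | Dn a => absz a end.
(* The [+ 1] brings the vertices 0 and 1 of both edges, which enter [frame], into the polygon. *)
pose m := (cd u + cd v + 1)%:Z.
have m0 : - m <= m by lia.
have [p [q [r [s [V [[Tpq Trs] [[h1 h2] [h3 h4]] V1 V0 VE]]]]]] := wide_frame HT m0 m0.
have iu : inside p q r s u.
  by rewrite /m in h1 h2 h3 h4; clear -h1 h2 h3 h4; case: u h1 h2 h3 h4 => a /=; lia.
have iv : inside p q r s v.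
  by rewrite /m in h1 h2 h3 h4; clear -h1 h2 h3 h4; case: v h1 h2 h3 h4 => a /=; lia.
have Ht := Phi_SL2_tiling HT.
have detE : det (frame (Phi T) u) (frame (Phi T) v) = det (V u) (V v).
  have m1 : 1 <= m by lia.
  have up : det (V (Up 0)) (V (Up 1)) = 1.
    by apply: V1; rewrite /vadj /= ?eqxx ?orbT //; lia.
  have dn : det (V (Dn 0)) (V (Dn 1)) = 1.
    by apply: V1; rewrite /vadj /= ?eqxx ?orbT //; lia.
  have bd w : (cd w)%:Z < m -> match w with Up a => p < a < r | Dn a => s < a < q end.
    by clear -h1 h2 h3 h4; case: w => a /=; lia.
  have := bd v ltac:(rewrite /m; lia); have := bd u ltac:(rewrite /m; lia).
  clearbody m; clear -up dn VE Ht h1 h2 h3 h4 m1 uv.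
  case: u v uv => [a|a] [b|b] //= ab ha hb.
  (* Cauchy-Binet: a minor of the table of determinants is the determinant of its two upper vectors
     times that of its two lower ones, here 1. *)
  - rewrite det_frame_Up !VE; [|lia..].
    by rewrite -[RHS]mulr1 -[in RHS]dn /det; ring.
  - by rewrite det_frame // VE //; lia.
  - rewrite det_frame_Dn // !VE; [|lia..].
    by rewrite -[RHS]mul1r -[in RHS]up /det; ring.
rewrite detE; apply/idP/eqP => [Tx|d1]; first by apply: V1; rewrite // /vadj Tx.
apply: Tm => // y Ty _; apply/negP => cr.
have [z [w [zw yE]]] := valid_arc_of (Tv _ Ty); subst y.
have /andP[iz iw] : inside p q r s z && inside p q r s w.
  apply: (crossing_inside _ _ iu iv uv zw cr); [by clear -h1 h2 m0; lia|by clear -h3 h4 m0; lia| |].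
    exact: (triangulation_noncrossing HT Ty Tpq).
  exact: (triangulation_noncrossing HT Ty Trs).
by apply: (@crossing_det V (inside p q r s) u v z w) => //; apply: V1; rewrite // /vadj Ty.
Qed.

(** [frame t] is unimodular for [unit_arcs t] by the choice of these arcs, so [Phi_det] may be
    applied to it. *)
Lemma Phi_unit_arcs t i j : is_SL2_tiling t -> enough_ones t -> Phi (unit_arcs t) i j = t i j.
Proof.
move=> Ht ones; have HT := unit_arcs_triangulation Ht ones.
have [p [q [r [s [Tpq Trs pir sjq]]]]] := Phi_choice i j HT.
rewrite (@Phi_det _ p q r s (frame t)) ?det_frame // => u v _ _ uv.
rewrite /vadj => /orP[/andP[_]|]; last exact: frame_side.
by rewrite ends_arc_of // => /eqP.
Qed.

Theorem mainTheorem1 :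
  (* Phi is well defined: independent of the admissible choice of arcs *)
  (forall T, is_triangulation T ->
     forall i j p q r s : int, T (Conn p q) -> T (Conn r s) ->
       p < i < r -> s < j < q -> Phi T i j = Phi_val T p q r s i j) /\
  (* Phi maps triangulations to SL2-tilings with enough ones *)
  (forall T, is_triangulation T -> is_SL2_tiling (Phi T) /\ enough_ones (Phi T)) /\
  (* injective *)
  (forall T1 T2, is_triangulation T1 -> is_triangulation T2 ->
     (forall i j, Phi T1 i j = Phi T2 i j) -> forall x, T1 x = T2 x) /\
  (* surjective *)
  (forall t, is_SL2_tiling t -> enough_ones t ->
     exists T, is_triangulation T /\ forall i j, Phi T i j = t i j).
Proof.
split; first by move=> T HT i j p q r s; apply: Phi_wd.
split; first by move=> T HT; split; [exact: Phi_SL2_tiling|exact: Phi_enough_ones].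
split=> [T1 T2 H1 H2 eqPhi x|t Ht ones].
  rewrite (triangulation_unit_arcs x H1) (triangulation_unit_arcs x H2) /unit_arcs.
  have eq_frame w : frame (Phi T1) w = frame (Phi T2) w by case: w => k /=; rewrite !eqPhi.
  by rewrite !eq_frame.
exists (unit_arcs t); split; first exact: unit_arcs_triangulation.
by move=> i j; apply: Phi_unit_arcs.
Qed.
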